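(* Let $E$ be a Polish space with Borel $\sigma$-algebra $\mathcal{B}(E)$, and let $\rho\in\mathcal{M}_+(E)$ be a nonzero reference measure with support $\mathrm{Supp}(\rho)\subset E$. Let $\kappa:\mathrm{Supp}(\rho)\times E\to(0,\infty)$ be a bounded continuous function, and consider the kernel operator $K:\mathcal{M}_+(E)\to\mathcal{M}_+(E)$ defined by $$K\mu(A)=\int_{A}\int_E\kappa(a,x)\,d\mu(x)\,d\rho(a),\quad A\in\mathcal{B}(E),\qquad\text{i.e.}\quad \frac{d(K\mu)}{d\rho}(a)=\int_E\kappa(a,x)\,d\mu(x).$$ Then the Birkhoff coefficient of $K$ is given by $$\tau(K)=\frac{1-\sqrt{\phi(K)}}{1+\sqrt{\phi(K)}},\qquad \phi(K)=\inf_{\substack{a,b\in\mathrm{Supp}(\rho)\\ x,y\in E}}\frac{\kappa(a,x)\,\kappa(b,y)}{\kappa(a,y)\,\kappa(b,x)}.$$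
   Context: $\mathcal{M}_+(E)$ is the set of finite non-negative Borel measures on $E$. For $\mu,\nu\in\mathcal{M}_+(E)\setminus\{0\}$, $\mathcal{H}(\mu,\nu)=\log\big(\beta(\mu,\nu)\beta(\nu,\mu)\big)\in[0,\infty]$, where $\beta(\mu,\nu)=\inf\{r>0: r\mu-\nu\in\mathcal{M}_+(E)\}$ with $\inf\emptyset=\infty$, and $\mathcal{T}(\mu,\nu)=\tanh(\mathcal{H}(\mu,\nu)/4)$ with $\tanh(\infty)=1$. The Birkhoff coefficient of $K$ is $\tau(K)=\sup_{\mu,\nu\in\mathcal{M}_+(E)\setminus\{0\}}\mathcal{T}(K\mu,K\nu)$. *)

(* Defs.v *)
From HB Require Import structures.
From mathcomp Require Import all_boot all_order all_algebra.
From mathcomp Require Import all_classical all_reals all_analysis.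
From mathcomp Require Import measurable_realfun.

Set Implicit Arguments.
Unset Strict Implicit.
Unset Printing Implicit Defensive.

Import Order.TTheory GRing.Theory Num.Theory.
Import numFieldNormedType.Exports.

Local Open Scope classical_set_scope.
Local Open Scope ring_scope.

Definition separable_space (T : topologicalType) : Prop :=
  exists2 D : set T, countable D & dense D.

Definition completely_metrizable (R : realType) (T : topologicalType) : Prop :=
  exists d : T -> T -> R,
    [/\ [/\ forall x y, 0 <= d x y,
            forall x y, d x y = 0 <-> x = y,
            forall x y, d x y = d y x &
            forall x y z, d x z <= d x y + d y z],
        forall (x : T) (A : set T),
          nbhs x A <-> exists2 e : R, 0 < e & [set y | d x y < e] `<=` A &
        forall u : nat -> T,
          (forall e : R, 0 < e ->
             exists N, forall m n, (N <= m)%N -> (N <= n)%N ->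
               d (u m) (u n) < e) ->
          exists l : T, u @ \oo --> l].

Definition polish_space (R : realType) (T : topologicalType) : Prop :=
  separable_space T /\ completely_metrizable R T.

Notation borel E := (g_sigma_algebraType (@open E)).

(* Library measures take (irrelevant) values on nonmeasurable sets too, so
   equalities between measures are tested on measurable sets only. *)

Notation fmeasure R T := {finite_measure set T -> \bar R}.

Definition nonzero_measure (d : measure_display) (T : measurableType d)
    (R : realType) (mu : fmeasure R T) : Prop :=
  exists2 A : set T, measurable A & mu A != 0%E.

Definition measure_support (R : realType) (E : ptopologicalType)
    (mu : fmeasure R (borel E)) : set E :=
  [set x | forall U : set E, open U -> U x -> (0 < mu U)%E].

(* The existential says that the signed measure r mu - nu is a finite
   nonnegative measure. *)
Definition birkhoff_beta (d : measure_display) (T : measurableType d) (R : realType)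
    (mu nu : fmeasure R T) : \bar R :=
  ereal_inf [set r%:E | r in [set r : R | 0 < r /\
    exists lam : fmeasure R T, forall A : set T, measurable A ->
      (lam A = r%:E * mu A - nu A)%E]].

Definition hilbert_metric (d : measure_display) (T : measurableType d)
    (R : realType) (mu nu : fmeasure R T) : \bar R :=
  lne (birkhoff_beta mu nu * birkhoff_beta nu mu)%E.

Definition tanhe (R : realType) (x : \bar R) : R :=
  match x with
  | r%:E => (expR r - expR (- r)) / (expR r + expR (- r))
  | +oo%E => 1
  | -oo%E => -1
  end.

Definition tanh_metric (d : measure_display) (T : measurableType d)
    (R : realType) (mu nu : fmeasure R T) : R :=
  tanhe (hilbert_metric mu nu * (4^-1)%:E)%E.

Definition birkhoff_coefficient (d : measure_display) (T : measurableType d)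
    (R : realType) (K : fmeasure R T -> fmeasure R T) : \bar R :=
  ereal_sup [set t : \bar R | exists mu nu : fmeasure R T,
    [/\ nonzero_measure mu, nonzero_measure nu &
        t = (tanh_metric (K mu) (K nu))%:E]].

(* kappa is only meaningful on measure_support rho x E; restricting the outer integral
   to the support costs nothing since its complement is rho-negligible. *)
Definition is_kernel_operator (R : realType) (E : ptopologicalType)
    (rho : fmeasure R (borel E)) (kappa : E -> E -> R)
    (K : fmeasure R (borel E) -> fmeasure R (borel E)) : Prop :=
  forall (mu : fmeasure R (borel E)) (A : set (borel E)), measurable A ->
    (K mu A =
      \int[rho]_(a in A `&` measure_support rho) \int[mu]_x (kappa a x)%:E)%E.

Definition density_measure (d : measure_display) (T : measurableType d)
    (R : realType) (rho : fmeasure R T) (S : set T) (f : T -> \bar R)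
    (mS : measurable S) (mf : measurable_fun S f)
    (f0 : forall x, S x -> (0 <= f x)%E)
    (finf : (\int[rho]_(x in S) f x < +oo)%E) : set T -> \bar R :=
  fun A => (\int[rho]_(x in A `&` S) f x)%E.

Section density_measure.
Context (d : measure_display) (T : measurableType d) (R : realType).
Context (rho : fmeasure R T) (S : set T) (f : T -> \bar R).
Context (mS : measurable S) (mf : measurable_fun S f).
Context (f0 : forall x, S x -> (0 <= f x)%E).
Context (finf : (\int[rho]_(x in S) f x < +oo)%E).

Let nu := density_measure mS mf f0 finf.

Let nu0 : nu set0 = 0%E.
Proof. by rewrite /nu /density_measure set0I integral_set0. Qed.

Let nu_ge0 A : (0 <= nu A)%E.
Proof. by apply: integral_ge0 => x [_ /f0]. Qed.

Let nu_sigma : semi_sigma_additive nu.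
Proof.
move=> /= F mF tF mUF; rewrite /nu /density_measure setI_bigcupl.
rewrite ge0_integral_bigcup//=.
- by apply: is_cvg_ereal_nneg_natsum_cond => // n _ _; exact: nu_ge0.
- by move=> k; exact: measurableI.
- rewrite -setI_bigcupl; apply: measurable_funS mf => //; exact: subIsetr.
- by rewrite -setI_bigcupl => x [_ /f0].
- exact: trivIset_setIr.
Qed.

HB.instance Definition _ := isMeasure.Build _ _ _ nu nu0 nu_ge0 nu_sigma.

Let nu_fin : fin_num_fun nu.
Proof.
move=> A mA; rewrite ge0_fin_numE//; apply: le_lt_trans finf.
apply: ge0_subset_integral => //; first exact: measurableI.
Qed.

HB.instance Definition _ := @Measure_isFinite.Build _ T _ nu nu_fin.

Lemma density_exists : exists lam : fmeasure R T,
  forall A, lam A = (\int[rho]_(x in A `&` S) f x)%E.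
Proof. by exists nu. Qed.
End density_measure.

(* The hypothesis is_kernel_operator rho kappa K is satisfiable: the double
   integral does define a finite measure. *)

Lemma kernel_operator_exists (R : realType) (E : ptopologicalType)
    (E_polish : polish_space R E)
    (rho : fmeasure R (borel E))
    (kappa : E -> E -> R)
    (kappa_gt0 : forall a x, measure_support rho a -> 0 < kappa a x)
    (kappa_bounded : exists M : R, forall a x,
       measure_support rho a -> kappa a x <= M)
    (kappa_continuous : {within measure_support rho `*` [set: E],
       continuous (fun p : E * E => kappa p.1 p.2)}) :
  exists K, is_kernel_operator rho kappa K.
Proof.
set S := measure_support rho in kappa_gt0 kappa_bounded kappa_continuous *.
have [_ [dist [[d0 dxx ds dt] dnbhs _]]] := E_polish.
have [M0 hM0] := kappa_bounded.
pose M := Num.max M0 1.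
have M_gt0 : 0 < M by rewrite lt_max ltr01 orbT.
have hM a x : S a -> kappa a x <= M.
  by move=> Sa; rewrite le_max hM0.
have cS : closed S.
  rewrite -[S]setCK; apply: open_closedC; rewrite openE => x.
  move=> /existsNP[U] /not_implyP[oU] /not_implyP[Ux nU].
  apply: filterS (open_nbhs_nbhs (conj oU Ux)).
  by move=> y Uy Sy; apply: nU; exact: Sy.
have opm (A : set E) : open A -> measurable (A : set (borel E)).
  by move=> oA; exact: sub_sigma_algebra.
have clm (A : set E) : closed A -> measurable (A : set (borel E)).
  move=> cA; rewrite -[A]setCK; apply: measurableC; apply: opm.
  exact: closed_openC.
have mS : measurable (S : set (borel E)) := clm S cS.
have kc a x : S a -> (fun p : E * E => kappa p.1 p.2) @
    within (S `*` [set: E]) (nbhs (a, x)) --> kappa a x.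
  by move=> Sa; move/subspace_continuousP : kappa_continuous; apply.
have cvk (a : nat -> E) b x : (forall n, S (a n)) -> S b -> a @ \oo --> b ->
    kappa (a n) x @[n --> \oo] --> kappa b x.
  move=> Sa Sb ab.
  have h : (a n, x) @[n --> \oo] --> (b, x).
    by apply: cvg_pair => //; exact: cvg_cst.
  move=> U /(kc b x Sb) /h; rewrite /= /nbhs/=.
  by apply: filterS => n Un; apply: Un; split => //; exact: Sa.
have mk a : S a -> measurable_fun [set: borel E] (fun x => (kappa a x)%:E).
  move=> Sa; apply/measurable_EFinP.
  apply: (measurability _ (RGenOpens.measurableE R)) => _ [_ [c [e ->]] <-].
  have oU : open `]c, e[%classic by exact: itv_open.
  move: `]c, e[%classic oU => U oU.
  rewrite setTI; apply: opm; rewrite openE => x Ux.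
  have [P [/= V1 V2] V12] := kc a x Sa U (open_nbhs_nbhs (conj oU Ux)).
  apply: filterS V2 => y V2y; apply: (V12 (a, y)) => //.
  by split => //=; exact: nbhs_singleton.
suff H (mu : fmeasure R (borel E)) : exists lam : fmeasure R (borel E), forall A,
   lam A = (\int[rho]_(a in A `&` S) \int[mu]_x (kappa a x)%:E)%E.
  have /choice[K HK] := H.
  by exists K => mu A _; rewrite HK.
have Fle a : S a -> (\int[mu]_x (kappa a x)%:E <= M%:E * mu setT)%E.
  move=> Sa; rewrite -integral_cst//; apply: ge0_le_integral => //.
  - by move=> x _; rewrite lee_fin ltW// kappa_gt0.
  - exact: mk.
  - by move=> x _; rewrite lee_fin; exact: hM.
have F0 a : S a -> (0 <= \int[mu]_x (kappa a x)%:E)%E.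
  by move=> Sa; apply: integral_ge0 => x _; rewrite lee_fin ltW// kappa_gt0.
have mF : measurable_fun (S : set (borel E)) (fun a => (\int[mu]_x (kappa a x)%:E)%E).
  move=> _; apply: (measurability _ (ErealGenOInfty.measurableE R)) => // _ [_ [c ->] <-].
  pose C := [set a | S a /\ (\int[mu]_x (kappa a x)%:E <= c%:E)%E].
  suff cC : closed C.
    rewrite [X in measurable X](_ : _ = S `\` C); last first.
      apply/seteqP; split => [a [Sa]|a [Sa Ca]] /=.
        rewrite in_itv/= andbT => ca; split => // -[_].
        by rewrite leNgt ca.
      split => //; rewrite /= in_itv/= andbT ltNge; apply/negP => h.
      by apply: Ca; split.
    by apply: measurableD; exact: clm.
  move=> b bC.
  have Sb : S b.
    by apply: cS => V /bC [y [[Sy _] Vy]]; exists y; split.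
  have /choice[a Ha] (n : nat) : exists a, C a /\ dist b a < n.+1%:R^-1.
    have /bC[a [Ca ba]] : nbhs b [set y | dist b y < n.+1%:R^-1].
      by apply/dnbhs; exists n.+1%:R^-1.
    by exists a.
  have ab : a @ \oo --> b.
    move=> V /dnbhs [e e0 eV].
    have := near_infty_natSinv_lt (PosNum e0).
    apply: (@filterS nat \oo) => n /= en; apply: eV => /=.
    by have [_ hn] := Ha n; exact: (lt_trans hn).
  have Sa n : S (a n) by have [[]] := Ha n.
  split => //.
  have [_ _ cv] : [/\ mu.-integrable setT (fun x => (kappa b x)%:E),
     [sequence \int[mu]_x `|(kappa (a n) x)%:E - (kappa b x)%:E|]_n @ \oo --> 0 &
     [sequence \int[mu]_x (kappa (a n) x)%:E]_n @ \oo --> \int[mu]_x (kappa b x)%:E]%E.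
    apply: (@dominated_convergence _ _ _ mu setT measurableT
      (fun n x => (kappa (a n) x)%:E) _ (cst M%:E)) => //.
    - by move=> n; exact: mk.
    - exact: mk.
    - by apply: aeW => x _; apply/cvg_EFin; [exact: nearW|exact: cvk].
    - by apply: finite_measure_integrable_cst.
    - apply: aeW => x n _ /=.
      by rewrite lee_fin ger0_norm ?hM// ltW// kappa_gt0.
  rewrite -(cvg_lim _ cv)//; apply: lime_le; first by apply/cvg_ex; eexists; exact: cv.
  by apply: nearW => n /=; have [[]] := Ha n.
apply: (density_exists mS) => //.
apply: (@le_lt_trans _ _ (\int[rho]_(x in S) (M%:E * mu setT))%E).
  apply: ge0_le_integral => //.
rewrite integral_cst//.
by rewrite ltey_eq !fin_numM// fin_num_measure.
Qed.

Definition cross_ratio_inf (R : realType) (E : Type) (S : set E) (kappa : E -> E -> R) : R :=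
  inf [set r : R | exists a b x y : E,
    [/\ S a, S b & r = (kappa a x * kappa b y) / (kappa a y * kappa b x)]].

(* Main.v *)
(* Write f_mu a for the integral of kappa a against mu. Since f_mu is continuous
   on S = Supp rho and every open set meeting S has positive rho-measure,
   r K mu - K nu is nonnegative iff f_nu <= r f_mu pointwise on S. Hence
   beta(K mu, K nu) beta(K nu, K mu) is the supremum over a, b in S of
   f_nu a f_mu b / (f_mu a f_nu b). Integrating the bound
   phi kappa(a,y) kappa(b,x) <= kappa(a,x) kappa(b,y) against mu and nu shows that
   it is at most 1/phi, and Dirac masses show that 1/phi is optimal. Finally
   tanh (log (1/r) / 4) = (1 - sqrt r) / (1 + sqrt r). *)
Require Import Defs.
From mathcomp Require Import all_boot all_order all_algebra.
From mathcomp Require Import all_classical all_reals all_analysis.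
From mathcomp Require Import measurable_realfun.
From mathcomp Require Import ring lra.

Set Implicit Arguments.
Unset Strict Implicit.
Unset Printing Implicit Defensive.

Import Order.TTheory GRing.Theory Num.Theory.
Import numFieldNormedType.Exports.
Local Open Scope classical_set_scope.
Local Open Scope ring_scope.

(** * Integration, Borel sets and sequential continuity *)

Lemma integral_gt0 (d : measure_display) (T : measurableType d) (R : realType)
    (mu : {measure set T -> \bar R}) (D : set T) (f : T -> \bar R) :
  measurable D -> measurable_fun D f -> (forall x, D x -> 0 < f x)%E ->
  (0 < mu D)%E -> (0 < \int[mu]_(x in D) f x)%E.
Proof.
move=> mD mf f0 muD.
have int_ge0 : (0 <= \int[mu]_(x in D) f x)%E.
  by apply: integral_ge0 => x Dx; exact/ltW/f0.
rewrite lt_neqAle int_ge0 andbT; apply/eqP => int0.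
have : (\int[mu]_(x in D) `|f x| = 0)%E.
  rewrite [RHS]int0; apply: eq_integral => x /set_mem Dx.
  by rewrite gee0_abs// ltW// f0.
(* A zero integral makes [f] vanish almost everywhere on [D]; since [f] is positive there, [D]
   itself lies in the null set [N]. *)
move/(ae_eq_integral_abs mu mD mf) => [N [mN N0 DN]].
suff : (mu D <= 0)%E by rewrite leNgt muD.
rewrite -N0; apply: le_measure; rewrite ?inE// => x Dx.
by apply: DN => /= /(_ Dx) fx0; move: (f0 x Dx); rewrite fx0 ltxx.
Qed.

Lemma borel_measurable_open (E : ptopologicalType) (A : set E) :
  open A -> measurable (A : set (borel E)).
Proof. by move=> oA; exact: sub_sigma_algebra. Qed.

Lemma borel_measurable_closed (E : ptopologicalType) (A : set E) :
  closed A -> measurable (A : set (borel E)).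
Proof.
move=> cA; rewrite -[A]setCK; apply: measurableC.
by apply: borel_measurable_open; exact: closed_openC.
Qed.

Lemma within_continuous_measurable (R : realType) (E : ptopologicalType)
    (S : set E) (f : E -> R) :
  measurable (S : set (borel E)) -> {within S, continuous f} ->
  measurable_fun (S : set (borel E)) f.
Proof.
move=> mS /continuousP cf.
apply: (measurability _ (RGenOpens.measurableE R)) => _ [_ [c [e ->]] <-].
have /cf/open_subspaceP[V oV VS] : open `]c, e[%classic by exact: itv_open.
rewrite setIC -VS.
by apply: measurableI => //; exact: borel_measurable_open.
Qed.

(** Balls of radius 1/(n+1) form a neighbourhood basis, so a failure of continuity at [b] yields a
    sequence in [S] tending to [b] whose images avoid [V]. This reduces continuity of the densities
    to dominated convergence. *)
Lemma seq_within_continuous (R : realType) (E : ptopologicalType)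
    (T : topologicalType) (S : set E) (f : E -> T) :
  completely_metrizable R E ->
  (forall (u : nat -> E) b, (forall n, S (u n)) -> S b -> u @ \oo --> b ->
    f \o u @ \oo --> f b) ->
  {within S, continuous f}.
Proof.
move=> [dist [[_ _ _ _] dnbhs _]] seqf; apply/subspace_continuousP => b Sb V Vfb.
rewrite /= nbhs_simpl /= withinE; apply: contrapT => nV.
have /choice[u Hu] (n : nat) :
    exists a, [/\ S a, ~ V (f a) & dist b a < n.+1%:R^-1].
  apply: contrapT => /forallNP na; apply: nV.
  exists (f @^-1` V `|` ~` S); last by rewrite setIUl setICl setU0.
  apply/dnbhs; exists n.+1%:R^-1; rewrite ?invr_gt0// => a /= ba.
  have [Sa|] := pselect (S a); [left|by right].
  by apply: contrapT => Va; apply: (na a).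
have ub : u @ \oo --> b.
  move=> W /dnbhs [e e0 eW].
  have := near_infty_natSinv_lt (PosNum e0).
  apply: (@filterS nat \oo) => n /= en; apply: eW => /=.
  by have [_ _ hn] := Hu n; exact: (lt_trans hn).
have Su n : S (u n) by have [] := Hu n.
have /filter_ex[n Vn] : \forall n \near \oo, V (f (u n)).
  exact: seqf Su Sb ub _ Vfb.
by have [] := Hu n.
Qed.

(** * The support is closed and carries the whole measure *)

Lemma closed_measure_support (R : realType) (E : ptopologicalType)
    (mu : fmeasure R (borel E)) : closed (measure_support mu).
Proof.
rewrite -[measure_support mu]setCK; apply: open_closedC; rewrite openE => x.
move=> /existsNP[U] /not_implyP[oU] /not_implyP[Ux nU].
apply: filterS (open_nbhs_nbhs (conj oU Ux)).
by move=> y Uy Sy; apply: nU; exact: Sy.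
Qed.

(* Second countability: every null open set is a union of null balls with
   centre in a countable dense set and radius 1/(n+1). *)
Lemma measure_support_conull (R : realType) (E : ptopologicalType)
    (mu : fmeasure R (borel E)) :
  polish_space R E -> mu (~` measure_support mu) = 0%E.
Proof.
move=> [[D cD dD] [dist [[_ dxx ds dt] dnbhs _]]].
have [g ginj] := countable_injP _ cD.
pose B (x : E) (n : nat) := (interior [set y | dist x y < n.+1%:R^-1] : set E).
(* Indexing by the code [k] of the centre makes the union run over natural numbers; as [g] is
   injective on [D], each [F k n] is empty or a single null ball. *)
pose F k n := \bigcup_(x in [set x | [/\ D x, g x = k & mu (B x n) = 0%E]]) B x n.
have F0 k n : mu.-negligible (F k n).
  have [[x [Dx gx x0]]|nx] :=
      pselect (exists x, [/\ D x, g x = k & mu (B x n) = 0%E]).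
    exists (B x n); split => //.
      by apply: borel_measurable_open; exact: open_interior.
    move=> z [y [Dy gy _]]; suff -> : y = x by [].
    by apply: ginj; rewrite ?inE// gx gy.
  by rewrite [F k n](_ : _ = set0);
    [exact: negligible_set0|apply/seteqP; split=> // z [y yP _]; apply: nx; exists y].
suff sub : ~` measure_support mu `<=` \bigcup_k \bigcup_n F k n.
  have N : mu.-negligible (~` measure_support mu).
    apply: (@negligibleS _ (borel E) R mu _ _ sub).
    by apply: negligible_bigcup => k; exact: negligible_bigcup.
  apply/(negligibleP _) => //; apply: measurableC.
  by apply: borel_measurable_closed; exact: closed_measure_support.
move=> x /existsNP[U] /not_implyP[oU] /not_implyP[Ux /negP].
rewrite -leNgt => U0.
have /dnbhs[e e0 eU] : nbhs x U by exact: open_nbhs_nbhs.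
(* With radius below [e / 2], a ball whose centre [y] is that close to [x] stays in [U] by the
   triangle inequality, hence is null. *)
have e20 : 0 < e / 2 by rewrite divr_gt0.
have [n ne] : exists n : nat, n.+1%:R^-1 < e / 2.
  by have /filter_ex := near_infty_natSinv_lt (PosNum e20).
have xB : nbhs x [set y | dist x y < n.+1%:R^-1].
  by apply/dnbhs; exists n.+1%:R^-1.
have [y [/= By Dy]] : exists y, ([set y | dist x y < n.+1%:R^-1] ° `&` D) y.
  apply: dD; last exact: open_interior.
  by exists x; exact: xB.
have xy : dist y x < n.+1%:R^-1 by rewrite ds; exact: (interior_subset By).
exists (g y) => //; exists n => //; exists y.
  split => //; apply/eqP; rewrite eq_le measure_ge0 andbT.
  apply: le_trans U0; apply: le_measure; rewrite ?inE.
  - by apply: borel_measurable_open; exact: open_interior.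
  - exact: borel_measurable_open.
  - move=> z /interior_subset/= yz; apply: eU => /=.
    apply: (le_lt_trans (dt x y z)); rewrite (splitr e); apply: ltrD.
      by apply: lt_trans ne; rewrite ds.
    exact: lt_trans ne.
rewrite /B /interior /=; apply/dnbhs.
exists (n.+1%:R^-1 - dist y x); rewrite ?subr_gt0// => z /= xz.
by apply: (le_lt_trans (dt y x z)); rewrite -ltrBrDl.
Qed.

(** * The kernel and the densities of its images *)

Section kernel.
Context (R : realType) (E : ptopologicalType) (E_polish : polish_space R E).
Context (S : set E) (cS : closed S) (kappa : E -> E -> R).
Context (kappa_gt0 : forall a x, S a -> 0 < kappa a x).
Context (kappa_bounded : exists M : R, forall a x, S a -> kappa a x <= M).
Context (kappa_continuous : {within S `*` [set: E],
  continuous (fun p : E * E => kappa p.1 p.2)}).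

(** This is the density of [K mu] with respect to [rho], taken real-valued so that quotients can be
    formed. For [a] in [S] nothing is lost, because [kappa a] is bounded and [mu] finite. *)
Definition kernel_density (mu : fmeasure R (borel E)) (a : E) : R :=
  \int[mu]_x kappa a x.

Let mS : measurable (S : set (borel E)) := borel_measurable_closed cS.

Lemma kernel_cvg (u v : nat -> E) a x : (forall n, S (u n)) -> S a ->
  u @ \oo --> a -> v @ \oo --> x -> kappa (u n) (v n) @[n --> \oo] --> kappa a x.
Proof.
move=> Su Sa ua vx V Vk.
have := (subspace_continuousP _ _).1 kappa_continuous (a, x) (conj Sa I) V Vk.
have h : (u n, v n) @[n --> \oo] --> (a, x) by exact: cvg_pair.
by move=> /h; rewrite /= /nbhs/=; apply: filterS => n; apply; split => //; exact: Su.
Qed.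

Lemma kernel_measurable a : S a -> measurable_fun [set: borel E] (kappa a).
Proof.
move=> Sa; apply: within_continuous_measurable; first exact: measurableT.
apply: (seq_within_continuous E_polish.2) => u b _ _ ub.
by apply: (@kernel_cvg (fun=> a)) => //; exact: cvg_cst.
Qed.

Lemma kernel_integrable (mu : fmeasure R (borel E)) a : S a ->
  mu.-integrable [set: borel E] (EFin \o kappa a).
Proof.
move=> Sa; have [M kM] := kappa_bounded.
apply: (le_integrable measurableT _ _
  (finite_measure_integrable_cst mu M measurableT)).
  by apply/measurable_EFinP; exact: kernel_measurable.
move=> x _ /=; rewrite lee_fin ger0_norm; last by rewrite ltW// kappa_gt0.
by apply: le_trans (ler_norm _); exact: kM.
Qed.

Lemma kernel_densityE (mu : fmeasure R (borel E)) a : S a ->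
  (\int[mu]_x (kappa a x)%:E = (kernel_density mu a)%:E)%E.
Proof.
move=> Sa; rewrite /kernel_density /Rintegral fineK//.
by apply: integrable_fin_num => //; exact: kernel_integrable.
Qed.

Lemma kernel_density_gt0 (mu : fmeasure R (borel E)) a : nonzero_measure mu ->
  S a -> 0 < kernel_density mu a.
Proof.
move=> [A mA muA] Sa; rewrite -lte_fin -kernel_densityE//.
apply: integral_gt0 => //.
- by apply/measurable_EFinP; exact: kernel_measurable.
- by move=> x _; rewrite lte_fin kappa_gt0.
- apply: (@lt_le_trans _ _ (mu A)); first by rewrite lt0e muA measure_ge0.
  by apply: le_measure; rewrite ?inE.
Qed.

Lemma kernel_density_bounded (mu : fmeasure R (borel E)) :
  exists M, forall a, S a -> `|kernel_density mu a| <= M.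
Proof.
have [M kM] := kappa_bounded; exists (M * fine (mu setT)) => a Sa.
have d0 : 0 <= kernel_density mu a.
  by apply: Rintegral_ge0 => x _; rewrite ltW// kappa_gt0.
rewrite ger0_norm// -lee_fin -kernel_densityE// EFinM fineK ?fin_num_measure//.
rewrite -integral_cst//; apply: ge0_le_integral => //.
- by move=> x _; rewrite lee_fin ltW// kappa_gt0.
- by apply/measurable_EFinP; exact: kernel_measurable.
- by move=> x _; rewrite lee_fin kM.
Qed.

(** Dominated convergence along a sequence in [S]: the constant bound of [kappa] dominates and is
    integrable since [mu] is finite. *)
Lemma kernel_density_continuous (mu : fmeasure R (borel E)) :
  {within S, continuous (kernel_density mu)}.
Proof.
apply: (seq_within_continuous E_polish.2) => u b Su Sb ub.
have [M kM] := kappa_bounded.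
have kmeas a : S a ->
    measurable_fun [set: borel E] (fun x => (kappa a x)%:E).
  by move=> Sa; apply/measurable_EFinP; exact: kernel_measurable.
have [_ _ cv] : [/\ mu.-integrable setT (fun x => (kappa b x)%:E),
   [sequence \int[mu]_x `|(kappa (u n) x)%:E - (kappa b x)%:E|]_n @ \oo --> 0 &
   [sequence \int[mu]_x (kappa (u n) x)%:E]_n @ \oo --> \int[mu]_x (kappa b x)%:E]%E.
  apply: (@dominated_convergence _ _ _ mu setT measurableT
    (fun n x => (kappa (u n) x)%:E) _ (cst M%:E)) => //.
  - by move=> n; exact: kmeas.
  - exact: kmeas.
  - apply: aeW => x _; apply/cvg_EFin; first exact: nearW.
    exact: (@kernel_cvg u (fun=> x)) (cvg_cst _).
  - exact: finite_measure_integrable_cst.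
  - by apply: aeW => x n _ /=; rewrite lee_fin ger0_norm ?kM// ltW// kappa_gt0.
move: cv; rewrite kernel_densityE// => cv.
exact: fine_cvg cv.
Qed.

Lemma kernel_density_integrable (rho mu : fmeasure R (borel E))
    (D : set (borel E)) : measurable D -> D `<=` S ->
  rho.-integrable D (EFin \o kernel_density mu).
Proof.
move=> mD DS; have [M dM] := kernel_density_bounded mu.
apply: (le_integrable mD _ _ (finite_measure_integrable_cst rho M mD)).
  apply/measurable_EFinP; apply: (measurable_funS mS DS).
  by apply: within_continuous_measurable => //; exact: kernel_density_continuous.
by move=> x Dx /=; rewrite lee_fin (le_trans _ (ler_norm _))// dM//; exact: DS.
Qed.

Lemma dirac_kernel_density (x a : borel E) : S a ->
  kernel_density (\d_x : {finite_measure set (borel E) -> \bar R}) a = kappa a x.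
Proof.
move=> Sa; apply: EFin_inj; rewrite -kernel_densityE// integral_dirac//.
  by rewrite diracT mul1e.
by apply/measurable_EFinP; exact: kernel_measurable.
Qed.

(* Fubini is avoided by integrating in one variable at a time. *)
Lemma kernel_density_cross_ratio (mu nu : fmeasure R (borel E)) (c : R) a b :
  S a -> S b ->
  (forall x y, c * (kappa a y * kappa b x) <= kappa a x * kappa b y) ->
  c * (kernel_density nu a * kernel_density mu b) <=
    kernel_density mu a * kernel_density nu b.
Proof.
move=> Sa Sb kc.
have mulI (la : fmeasure R (borel E)) e r : S e ->
    la.-integrable [set: borel E] (EFin \o (fun x => r * kappa e x)).
  by move=> Se; exact: (integrableZl measurableT r (kernel_integrable la Se)).
have densZ (la : fmeasure R (borel E)) e r : S e ->
    \int[la]_x (r * kappa e x) = r * kernel_density la e.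
  by move=> Se; rewrite RintegralZl//; exact: kernel_integrable.
(* First integration: in [y] against [nu], with [x] fixed. The second, in [x] against [mu],
   concludes. *)
have step x : c * kernel_density nu a * kappa b x <= kernel_density nu b * kappa a x.
  rewrite mulrAC [leRHS]mulrC -!densZ//.
  apply: le_Rintegral => //; try exact: mulI.
  by move=> y _; rewrite -mulrA (mulrC (kappa b x)).
rewrite mulrA [leRHS]mulrC -(densZ mu b)// -(densZ mu a)//.
by apply: le_Rintegral => //; exact: mulI.
Qed.

(** * The operator [K] and pointwise domination of densities *)

Context (rho : fmeasure R (borel E)) (rhoS : rho (~` S) = 0%E).
Context (rhoS_gt0 : forall V a, open V -> V a -> S a -> (0 < rho V)%E).
Context (K : fmeasure R (borel E) -> fmeasure R (borel E)).
Context (K_def : forall (mu : fmeasure R (borel E)) (A : set (borel E)),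
  measurable A ->
  (K mu A = \int[rho]_(a in A `&` S) \int[mu]_x (kappa a x)%:E)%E).

Lemma kernel_operatorE (mu : fmeasure R (borel E)) (A : set (borel E)) :
  measurable A -> (K mu A = \int[rho]_(a in A `&` S) (kernel_density mu a)%:E)%E.
Proof.
move=> mA; rewrite K_def//; apply: eq_integral => a /set_mem[_ Sa].
exact: kernel_densityE.
Qed.

Lemma kernel_operatorB (mu nu : fmeasure R (borel E)) (r : R) (A : set (borel E)) :
  measurable A ->
  (r%:E * K mu A - K nu A =
    \int[rho]_(a in A `&` S) (r * kernel_density mu a - kernel_density nu a)%:E)%E.
Proof.
move=> mA; have mAS : measurable (A `&` S) by exact: measurableI.
have I la : rho.-integrable (A `&` S) (EFin \o kernel_density la).
  by apply: kernel_density_integrable => //; exact: subIsetr.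
rewrite !kernel_operatorE// -integralZl//; last exact: I.
rewrite -integralB//; [exact: (integrableZl mAS r (I mu))|exact: I].
Qed.

(** The function [g] is the density of [r K mu - K nu]. If it is negative at a point of [S],
    continuity makes it negative on a relatively open set of positive [rho]-measure. Conversely, a
    non-negative [g] is the density of a finite measure. *)
Lemma kernel_operator_dominatedP (mu nu : fmeasure R (borel E)) (r : R) :
  (exists lam : fmeasure R (borel E), forall A, measurable A ->
      (lam A = r%:E * K mu A - K nu A)%E) <->
  (forall a, S a -> kernel_density nu a <= r * kernel_density mu a).
Proof.
pose g a := r * kernel_density mu a - kernel_density nu a.
have cg : {within S, continuous g}.
  move=> x; apply: cvgB; last exact: kernel_density_continuous.
  by apply: cvgM; [exact: cvg_cst|exact: kernel_density_continuous].
have gI (D : set (borel E)) : measurable D -> D `<=` S ->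
    rho.-integrable D (EFin \o g).
  move=> mD DS; apply: (@integrableB _ _ _ rho D mD
    (fun a => (r * kernel_density mu a)%:E) (EFin \o kernel_density nu)).
    exact: (integrableZl mD r (kernel_density_integrable rho mu mD DS)).
  exact: kernel_density_integrable.
split=> [[lam lamE] a Sa|dom].
  rewrite -subr_ge0 leNgt; apply/negP => ga.
  have /continuousP/(_ `]-oo, 0[%classic (@lray_open _ _ _))/open_subspaceP[V oV VS] := cg.
  have VSg b : (V `&` S) b -> S b /\ g b < 0.
    by rewrite VS => -[/=]; rewrite in_itv.
  have Va : V a.
    suff : (V `&` S) a by case.
    by rewrite VS; split => //=; rewrite in_itv.
  have mV : measurable (V : set (borel E)) := borel_measurable_open oV.
  have mVS : measurable (V `&` S : set (borel E)) by exact: measurableI.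
  have /lamE lamV := mV.
  (* Only [rho V] is known to be positive; intersecting with [S] removes a null set. *)
  have rhoVS : (0 < rho (V `&` S))%E.
    suff <- : rho V = rho (V `&` S) by exact: rhoS_gt0 Sa.
    apply/eqP; rewrite eq_le; apply/andP; split; last first.
      by apply: le_measure; rewrite ?inE.
    rewrite -[leRHS]adde0 -rhoS.
    apply: (le_trans _ (measureU2 _ _ _)) => //; last exact: measurableC.
    apply: le_measure; rewrite ?inE//.
      by apply: measurableU => //; exact: measurableC.
    by move=> z Vz; have [Sz|] := pselect (S z); [left|right].
  (* Integrating [-g] gives [- lam V > 0], against non-negativity of [lam]. *)
  have : (0 < \int[rho]_(b in V `&` S) ((-1)%:E * (g b)%:E))%E.
    apply: integral_gt0 => //.
    - apply: emeasurable_funM => //; apply/measurable_EFinP.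
      apply: (measurable_funS mS (@subIsetr _ _ _)).
      exact: within_continuous_measurable.
    - by move=> b /VSg[_ gb]; rewrite -EFinM lte_fin mulN1r oppr_gt0.
  rewrite integralZl//; last exact: (gI _ mVS (@subIsetr _ _ _)).
  by rewrite -kernel_operatorB// -lamV mulN1e oppe_gt0 ltNge measure_ge0.
have gge0 a : S a -> (0 <= (g a)%:E)%E.
  by move=> Sa; rewrite lee_fin subr_ge0 dom.
have mg : measurable_fun (S : set (borel E)) (fun a => (g a)%:E).
  by apply/measurable_EFinP; exact: within_continuous_measurable.
have gfin : (\int[rho]_(x in S) (g x)%:E < +oo)%E.
  by rewrite -(setTI S) -kernel_operatorB// ltey_eq fin_numB fin_numM// !fin_num_measure.
have [lam lamE] := density_exists mS mg gge0 gfin.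
by exists lam => A mA; rewrite lamE kernel_operatorB.
Qed.

(** * Bounds on the product of the two Birkhoff constants *)

Lemma kernel_birkhoff_beta_ge (mu nu : fmeasure R (borel E)) a :
  nonzero_measure mu -> S a ->
  ((kernel_density nu a / kernel_density mu a)%:E <= birkhoff_beta (K mu) (K nu))%E.
Proof.
move=> mu0 Sa; apply: le_ereal_inf_tmp => _ [r [r0 /kernel_operator_dominatedP dom] <-].
by rewrite lee_fin ler_pdivrMr ?dom// kernel_density_gt0.
Qed.

Lemma kernel_birkhoff_beta_le (mu nu : fmeasure R (borel E)) (r : R) :
  0 < r -> (forall a, S a -> kernel_density nu a <= r * kernel_density mu a) ->
  (birkhoff_beta (K mu) (K nu) <= r%:E)%E.
Proof.
move=> r0 dom; apply: ereal_inf_lbound; exists r => //; split => //.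
exact/kernel_operator_dominatedP.
Qed.

Lemma kernel_birkhoff_betaM_ge (mu nu : fmeasure R (borel E)) a b :
  nonzero_measure mu -> nonzero_measure nu -> S a -> S b ->
  ((kernel_density nu a * kernel_density mu b /
      (kernel_density mu a * kernel_density nu b))%:E <=
    birkhoff_beta (K mu) (K nu) * birkhoff_beta (K nu) (K mu))%E.
Proof.
move=> mu0 nu0 Sa Sb; rewrite -mulf_div EFinM.
apply: lee_pmul; try exact: kernel_birkhoff_beta_ge.
- by rewrite lee_fin divr_ge0// ltW// kernel_density_gt0.
- by rewrite lee_fin divr_ge0// ltW// kernel_density_gt0.
Qed.

(** For each [b] the hypothesis makes [c^-1 f_nu b / f_mu b] admissible for the first constant [t].
    Letting [b] vary, [t <= c^-1 f_nu b / f_mu b] says that [c^-1 / t] is admissible for the second,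
    and the product is at most [c^-1]. *)
Lemma kernel_birkhoff_betaM_le (mu nu : fmeasure R (borel E)) (c : R) :
  S !=set0 -> nonzero_measure mu -> nonzero_measure nu -> 0 < c ->
  (forall a b, S a -> S b ->
    c * (kernel_density nu a * kernel_density mu b) <=
      kernel_density mu a * kernel_density nu b) ->
  (birkhoff_beta (K mu) (K nu) * birkhoff_beta (K nu) (K mu) <= (c^-1)%:E)%E.
Proof.
move=> [a0 Sa0] mu0 nu0 c0 dom.
have dmu a : S a -> 0 < kernel_density mu a by exact: kernel_density_gt0.
have dnu a : S a -> 0 < kernel_density nu a by exact: kernel_density_gt0.
have beta_le b : S b -> (birkhoff_beta (K mu) (K nu) <=
    (c^-1 * (kernel_density nu b / kernel_density mu b))%:E)%E.
  move=> Sb; apply: kernel_birkhoff_beta_le => [|a Sa].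
    by rewrite mulr_gt0 ?invr_gt0// divr_gt0 ?dmu ?dnu.
  rewrite mulrA mulrAC ler_pdivlMr ?dmu// -mulrA ler_pdivlMl//.
  by rewrite [X in _ <= X]mulrC dom.
(* The two bounds at [a0] make the first constant finite and positive, so that division by [t] is
   legitimate. *)
have := kernel_birkhoff_beta_ge nu mu0 Sa0.
case: (birkhoff_beta (K mu) (K nu)) beta_le => [t|/(_ _ Sa0)|//]; last first.
  by rewrite leye_eq.
move=> beta_le; rewrite lee_fin => /(lt_le_trans (divr_gt0 (dnu _ Sa0) (dmu _ Sa0))) t0.
have beta'_le : (birkhoff_beta (K nu) (K mu) <= (c^-1 / t)%:E)%E.
  apply: kernel_birkhoff_beta_le => [|b Sb]; first by rewrite divr_gt0 ?invr_gt0.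
  have := beta_le _ Sb; rewrite lee_fin mulrA ler_pdivlMr ?dmu// => h.
  by rewrite mulrAC ler_pdivlMr// mulrC.
apply: (@le_trans _ _ (t%:E * (c^-1 / t)%:E)%E).
  by rewrite lee_pmul2l.
by rewrite -EFinM mulrC divfK ?gt_eqF.
Qed.

End kernel.

(** * The hyperbolic tangent and the map s -> (1 - s) / (1 + s) *)

Lemma tanhe_le1 (R : realType) (x : \bar R) : tanhe x <= 1.
Proof.
case: x => [r||] //=.
rewrite ler_pdivrMr ?addr_gt0 ?expR_gt0// mul1r.
by have := expR_ge0 (- r); lra.
Qed.

Lemma tanhe_ge_N1 (R : realType) (x : \bar R) : -1 <= tanhe x.
Proof.
case: x => [r||] //=.
rewrite ler_pdivlMr ?addr_gt0 ?expR_gt0//.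
by have := expR_ge0 r; lra.
Qed.

Lemma le_tanhe (R : realType) (x y : \bar R) : (x <= y)%E -> tanhe x <= tanhe y.
Proof.
case: x => [r||]; last 2 first.
- by rewrite leye_eq => /eqP ->.
- by move=> _; exact: tanhe_ge_N1.
case: y => [s||]; last 2 first.
- by move=> _; exact: tanhe_le1.
- by rewrite leeNy_eq.
rewrite lee_fin => rs /=.
have rs1 : expR r <= expR s by rewrite ler_expR.
have rs2 : expR (- s) <= expR (- r) by rewrite ler_expR lerN2.
rewrite ler_pdivrMr ?addr_gt0 ?expR_gt0// mulrAC ler_pdivlMr ?addr_gt0 ?expR_gt0//.
(* After cross-multiplication and cancellation, twice this inequality is all that remains. *)
have : expR r * expR (- s) <= expR s * expR (- r).
  by apply: ler_pM; rewrite ?expR_ge0.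
nra.
Qed.

Lemma le_tanh_lne (R : realType) (x y : \bar R) : (0 <= x)%E -> (x <= y)%E ->
  tanhe (lne x * (4^-1)%:E)%E <= tanhe (lne y * (4^-1)%:E)%E.
Proof.
move=> x0 xy; apply: le_tanhe; apply: lee_wpmul2r; first by rewrite lee_fin.
by rewrite lee_lne// !in_itv/= !leey !andbT// (le_trans x0).
Qed.

(** With [u = expR (ln r / 4)], the left side is [(u^-1 - u) / (u^-1 + u) = (1 - u^2) / (1 + u^2)],
    and [u^2] is the square root of [r]. *)
Lemma tanh_lneV (R : realType) (r : R) : 0 < r ->
  tanhe (lne (r^-1)%:E * (4^-1)%:E)%E = (1 - Num.sqrt r) / (1 + Num.sqrt r).
Proof.
move=> r0; rewrite lne_EFin ?invr_gt0//= lnV// mulNr opprK.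
set u := expR (ln r / 4); have u0 : 0 < u by exact: expR_gt0.
have -> : Num.sqrt r = u ^+ 2.
  rewrite -[in LHS](lnK (x := r))// -(ger0_norm (ltW (exprn_gt0 2 u0))) -sqrtr_sqr.
  by rewrite -exprM -expRM_natl; congr (Num.sqrt (expR _)); field.
rewrite expRN -/u; field.
by rewrite ?gt_eqF ?addr_gt0 ?exprn_gt0.
Qed.

(** The map s -> (1 - s) / (1 + s) is decreasing and its own inverse for s > -1. The bound by [c]
    thus becomes a lower bound on [Num.sqrt r], hence on [r] after squaring, and passes to the
    infimum. *)
Lemma mobius_sqrt_inf_le (R : realType) (A : set R) (c : R) :
  A !=set0 -> (forall r, A r -> 0 <= r) ->
  (forall r, A r -> (1 - Num.sqrt r) / (1 + Num.sqrt r) <= c) ->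
  (1 - Num.sqrt (inf A)) / (1 + Num.sqrt (inf A)) <= c.
Proof.
move=> A0 Age Ac.
have s1 (x : R) : 0 < 1 + Num.sqrt x by rewrite ltr_pwDl// sqrtr_ge0.
(* For [c >= 1] the claim is trivial; otherwise [(1 - c) / (1 + c)] is non-negative and may be
   squared. *)
have [c1|c1] := leP 1 c.
  apply: le_trans c1; rewrite ler_pdivrMr// mul1r.
  by have := sqrtr_ge0 (inf A); lra.
have [r0 Ar0] := A0.
have cN1 : 0 < 1 + c.
  have := Ac _ Ar0; rewrite ler_pdivrMr//.
  have := sqrtr_ge0 r0.
  nra.
have q0 : 0 <= (1 - c) / (1 + c) by rewrite divr_ge0 ?subr_ge0 ?(ltW c1) ?(ltW cN1).
have qP x : ((1 - Num.sqrt x) / (1 + Num.sqrt x) <= c) =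
    ((1 - c) / (1 + c) <= Num.sqrt x).
  rewrite ler_pdivrMr// ler_pdivrMr//.
  by apply/idP/idP; lra.
rewrite qP -[leLHS]ger0_norm// -sqrtr_sqr ler_wsqrtr//.
apply: lb_le_inf => // r Ar.
have := Ac _ Ar; rewrite qP => h.
by rewrite -(sqr_sqrtr (Age _ Ar)) ler_sqr ?nnegrE ?sqrtr_ge0.
Qed.

(** * The two inequalities between the Birkhoff coefficient and the cross-ratio formula *)

Theorem proposition4p2 (R : realType) (E : ptopologicalType)
    (E_polish : polish_space R E)
    (rho : fmeasure R (borel E)) (rho_neq0 : nonzero_measure rho)
    (kappa : E -> E -> R)
    (kappa_gt0 : forall a x, measure_support rho a -> 0 < kappa a x)
    (kappa_bounded : exists M : R, forall a x, measure_support rho a -> kappa a x <= M)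
    (kappa_continuous : {within measure_support rho `*` [set: E],
       continuous (fun p : E * E => kappa p.1 p.2)})
    (K : fmeasure R (borel E) -> fmeasure R (borel E))
    (K_def : is_kernel_operator rho kappa K) :
  birkhoff_coefficient K =
    ((1 - Num.sqrt (cross_ratio_inf (measure_support rho) kappa)) /
     (1 + Num.sqrt (cross_ratio_inf (measure_support rho) kappa)))%:E.
Proof.
set S := measure_support rho in kappa_gt0 kappa_bounded kappa_continuous *.
have cS : closed S by exact: closed_measure_support.
have rhoS : rho (~` S) = 0%E := measure_support_conull rho E_polish.
have rhoS_gt0 V a : open V -> V a -> S a -> (0 < rho V)%E.
  by move=> oV Va; apply.
have S0 : S !=set0.
  have [A mA rhoA] := rho_neq0; apply/set0P/eqP => S0.
  move: rhoS; rewrite S0 setC0 => rhoT; move/eqP: rhoA; apply.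
  apply/eqP; rewrite eq_le measure_ge0 andbT -rhoT.
  by apply: le_measure; rewrite ?inE.
have [a0 Sa0] := S0.
have dens_gt0 := kernel_density_gt0 E_polish kappa_gt0 kappa_bounded
  kappa_continuous.
have betaM_ge := @kernel_birkhoff_betaM_ge _ _ E_polish _ cS _ kappa_gt0
  kappa_bounded kappa_continuous _ rhoS rhoS_gt0 _ K_def.
rewrite /cross_ratio_inf; set A := (X in inf X).
have A0 : A !=set0 by exists ((kappa a0 point * kappa a0 point) /
  (kappa a0 point * kappa a0 point)), a0, a0, point, point.
have A_gt0 r : A r -> 0 < r.
  by move=> [a [b [x [y [Sa Sb ->]]]]]; rewrite divr_gt0 ?mulr_gt0 ?kappa_gt0.
have A_ge0 r : A r -> 0 <= r by move=> /A_gt0/ltW.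
have infA0 : 0 <= inf A by exact: lb_le_inf.
apply/eqP; rewrite eq_le; apply/andP; split.
  apply: ge_ereal_sup => _ [mu [nu [mu0 nu0 ->]]]; rewrite lee_fin.
  (* If the infimum is 0 the claimed bound is 1, which [tanhe] never exceeds. *)
  move: infA0; rewrite le_eqVlt => /predU1P[<-|infA_gt0].
    by rewrite sqrtr0 subr0 addr0 divr1; exact: tanhe_le1.
  rewrite -tanh_lneV//; apply: le_tanh_lne.
    (* Monotonicity of [lne] requires a non-negative product; the lower bound at the pair [a0], [a0]
       provides it. *)
    apply: le_trans (betaM_ge _ _ _ _ mu0 nu0 Sa0 Sa0).
    by rewrite lee_fin divr_ge0// mulr_ge0// ltW// dens_gt0.
  apply: (kernel_birkhoff_betaM_le E_polish cS kappa_gt0 kappa_bounded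
    kappa_continuous rhoS rhoS_gt0 K_def S0 mu0 nu0) => // a b Sa Sb.
  apply: (kernel_density_cross_ratio E_polish kappa_gt0 kappa_bounded) => //.
  move=> x y; rewrite -ler_pdivlMr ?mulr_gt0 ?kappa_gt0//.
  apply: ge_inf; last by exists a, b, x, y.
  by exists 0 => r /A_ge0.
set B := birkhoff_coefficient K.
(* For Dirac masses at [x] and [y] the densities are [kappa a x] and [kappa a y], so the lower bound
   at [a], [b] is exactly [r^-1]. *)
have B_ge r : A r -> (((1 - Num.sqrt r) / (1 + Num.sqrt r))%:E <= B)%E.
  move=> Ar; have r0 := A_gt0 _ Ar.
  have [a [b [x [y [Sa Sb rE]]]]] := Ar.
  have dirac0 z : nonzero_measure (\d_z : fmeasure R (borel E)).
    by exists setT => //=; rewrite diracE mem_set// oner_neq0.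
  apply: (@le_trans _ _ (tanh_metric (K (\d_(x : borel E))) (K (\d_(y : borel E))))%:E).
    rewrite lee_fin -tanh_lneV//; apply: le_tanh_lne; first by rewrite lee_fin invr_ge0 ltW.
    have := betaM_ge _ _ _ _ (dirac0 x) (dirac0 y) Sa Sb.
    rewrite !(dirac_kernel_density E_polish kappa_gt0 kappa_bounded)//.
    by rewrite rE invf_div.
  by apply: ereal_sup_ubound; exists (\d_(x : borel E)), (\d_(y : borel E)).
have [r1 Ar1] := A0.
(* A finite supremum is handled by passing to the infimum of [A]; the element [r1] of [A] excludes
   the value -oo. *)
case: B B_ge => [c||] B_ge.
- by rewrite lee_fin; apply: mobius_sqrt_inf_le => // r /B_ge; rewrite lee_fin.
- by rewrite leey.
- by have := B_ge _ Ar1; rewrite leeNy_eq.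
Qed.
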